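(* If $(\mathfrak{g},[\cdot,\dots,\cdot]_{\mathfrak{g}},\alpha,\beta)$ is an $n$-BiHom-Lie algebra with $H^2(\mathfrak{g},\mathfrak{g})=0$, then $(\mathfrak{g},[\cdot,\dots,\cdot]_{\mathfrak{g}},\alpha,\beta)$ is analytically rigid.
   Context: $\mathbb{K}$ is an algebraically closed field of characteristic $0$, all vector spaces are over $\mathbb{K}$, $n\ge 2$, and a hat denotes omission of an entry. An $n$-BiHom-Lie algebra $(\mathfrak{g},[\cdot,\dots,\cdot]_{\mathfrak{g}},\alpha,\beta)$ is a vector space $\mathfrak{g}$ with an $n$-linear operation $[\cdot,\dots,\cdot]_{\mathfrak{g}}:\mathfrak{g}^n\to\mathfrak{g}$ and linear maps $\alpha,\beta:\mathfrak{g}\to\mathfrak{g}$ such that for all elements of $\mathfrak g$: (1) $\alpha\circ\beta=\beta\circ\alpha$; (2) $\alpha([x_1,\dots,x_n]_{\mathfrak{g}})=[\alpha(x_1),\dots,\alpha(x_n)]_{\mathfrak{g}}$ and $\beta([x_1,\dots,x_n]_{\mathfrak{g}})=[\beta(x_1),\dots,\beta(x_n)]_{\mathfrak{g}}$; (3) (BiHom-skewsymmetry) $[\beta(x_1),\dots,\beta(x_{n-1}),\alpha(x_n)]_{\mathfrak{g}}$ changes sign when $x_k$ and $x_{k+1}$ are exchanged ($1\le k\le n-2$), and $[\beta(x_1),\dots,\beta(x_{n-1}),\alpha(x_n)]_{\mathfrak{g}}=-[\beta(x_1),\dots,\beta(x_{n-2}),\beta(x_n),\alpha(x_{n-1})]_{\mathfrak{g}}$;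 (4) ($n$-BiHom-Jacobi identity) $[\beta^2(x_1),\dots,\beta^2(x_{n-1}),[\beta(y_1),\dots,\beta(y_{n-1}),\alpha(y_n)]_{\mathfrak{g}}]_{\mathfrak{g}}=\sum_{k=1}^n(-1)^{n-k}[\beta^2(y_1),\dots,\widehat{\beta^2(y_k)},\dots,\beta^2(y_n),[\beta(x_1),\dots,\beta(x_{n-1}),\alpha(y_k)]_{\mathfrak{g}}]_{\mathfrak{g}}$. Cohomology. $C^1(\mathfrak{g},\mathfrak{g})$ is the space of linear maps $f:\mathfrak{g}\to\mathfrak{g}$ with $f\circ\alpha=\alpha\circ f$ and $f\circ\beta=\beta\circ f$. $C^2(\mathfrak{g},\mathfrak{g})$ is the space of $n$-linear maps $f:\mathfrak{g}^n\to\mathfrak{g}$ with $\alpha(f(x_1,\dots,x_n))=f(\alpha(x_1),\dots,\alpha(x_n))$, $\beta(f(x_1,\dots,x_n))=f(\beta(x_1),\dots,\beta(x_n))$, and which are BiHom-skewsymmetric (i.e. satisfy (3) with $f$ in place of the bracket). For $f\in C^1(\mathfrak{g},\mathfrak{g})$, $$\delta^1f(x_1,\dots,x_n)=-f([x_1,\dots,x_n]_{\mathfrak{g}})+\sum_{i=1}^n[x_1,\dots,f(x_i),\dots,x_n]_{\mathfrak{g}},$$ and for $f\in C^2(\mathfrak{g},\mathfrak{g})$, $$\delta^2f(x_1,\dots,x_{n-1},y_1,\dots,y_n)=[\beta^2(x_1),\dots,\beta^2(x_{n-1}),f(\beta(y_1),\dots,\beta(y_{n-1}),\alpha(y_n))]_{\mathfrak{g}}+f(\beta^2(x_1),\dots,\beta^2(x_{n-1}),[\beta(y_1),\dots,\beta(y_{n-1}),\alpha(y_n)]_{\mathfrak{g}})$$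 $$-\sum_{i=1}^n(-1)^{n-i}\Big([\beta^2(y_1),\dots,\widehat{\beta^2(y_i)},\dots,\beta^2(y_n),f(\beta(x_1),\dots,\beta(x_{n-1}),\alpha(y_i))]_{\mathfrak{g}}+f(\beta^2(y_1),\dots,\widehat{\beta^2(y_i)},\dots,\beta^2(y_n),[\beta(x_1),\dots,\beta(x_{n-1}),\alpha(y_i)]_{\mathfrak{g}})\Big).$$ Put $Z^2(\mathfrak{g},\mathfrak{g})=\{f\in C^2(\mathfrak{g},\mathfrak{g}):\delta^2f=0\}$, $B^2(\mathfrak{g},\mathfrak{g})=\delta^1C^1(\mathfrak{g},\mathfrak{g})\subseteq Z^2(\mathfrak{g},\mathfrak{g})$, and $H^2(\mathfrak{g},\mathfrak{g})=Z^2(\mathfrak{g},\mathfrak{g})/B^2(\mathfrak{g},\mathfrak{g})$. Deformations. A deformation of $(\mathfrak{g},[\cdot,\dots,\cdot]_{\mathfrak{g}},\alpha,\beta)$ is a $\mathbb{K}[[t]]$-$n$-linear map $f_t=\sum_{p\ge0}f_pt^p:\mathfrak{g}[[t]]\times\dots\times\mathfrak{g}[[t]]\to\mathfrak{g}[[t]]$, with $f_p:\mathfrak{g}^n\to\mathfrak{g}$ $n$-linear and $f_0=[\cdot,\dots,\cdot]_{\mathfrak{g}}$, such that $(\mathfrak{g}[[t]],f_t,\alpha,\beta)$ ($\alpha,\beta$ extended $\mathbb{K}[[t]]$-linearly) is an $n$-BiHom-Lie algebra, i.e. satisfies (1)-(4). Two deformations $f_t,f'_t$ are equivalent if there is a formal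 automorphism $\Psi_t=\sum_{i\ge0}\psi_it^i$, with $\psi_i:\mathfrak{g}\to\mathfrak{g}$ linear, $\psi_0=\mathrm{id}_{\mathfrak{g}}$, $\psi_i\circ\alpha=\alpha\circ\psi_i$, $\psi_i\circ\beta=\beta\circ\psi_i$, such that $\Psi_t\circ f_t(x_1,\dots,x_n)=f'_t(\Psi_t(x_1),\dots,\Psi_t(x_n))$ for all $x_i$. The null deformation is $f_t=f_0$ (all $f_p=0$ for $p\ge1$). The algebra is analytically rigid if every deformation $f_t$ is equivalent to the null deformation $f_0$. *)

(* Defs.v *)
From HB Require Import structures.
From mathcomp Require Import all_boot all_order all_fingroup all_algebra.
From mathcomp Require Import ring_quotient.
From mathcomp Require Import boolp classical_sets functions.

Set Implicit Arguments.
Unset Strict Implicit.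
Unset Printing Implicit Defensive.

Import GRing.Theory.
Local Open Scope ring_scope.
Local Open Scope classical_set_scope.

(* Elements of V^n are functions 'I_n -> V, so the argument x_k of a bracket
   is x (k - 1). *)

Section Arguments.
Variables (n : nat) (V : Type).

(* (x_1, ..., x_(i-1), u, x_(i+1), ..., x_n) *)
Definition set_arg (x : 'I_n -> V) (i : 'I_n) (u : V) : 'I_n -> V :=
  fun j => if j == i then u else x j.

(* (x_1, ..., x_(n-1), z); insub sends an index i < n - 1 to Some i and the
   last index to None *)
Definition with_last (x : 'I_n.-1 -> V) (z : V) : 'I_n -> V :=
  fun i => if insub (i : nat) is Some j then x j else z.

(* (y_1, ..., y_(k-1), y_(k+1), ..., y_n) *)
Definition omit (y : 'I_n -> V) (k : 'I_n) : 'I_n.-1 -> V :=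
  fun j => y (lift k j).

(* (b x_1, ..., b x_(n-1), a x_n) *)
Definition twist (a b : V -> V) (x : 'I_n -> V) : 'I_n -> V :=
  fun i => if i.+1 == n then a (x i) else b (x i).

End Arguments.

Section BiHomLie.
Variables (R : comNzRingType) (n : nat) (V : lmodType R).
Implicit Types (f br : ('I_n -> V) -> V) (a b : V -> V).

Definition multilinear f : Prop :=
  forall (x : 'I_n -> V) (i : 'I_n) (c : R) (u v : V),
    f (set_arg x i (c *: u + v)) =
      c *: f (set_arg x i u) + f (set_arg x i v).

(* The exchange of x_(n-1) and x_n, i.e. the case where l is the last index,
   takes place before a and b are applied: it is the identity
   f(b x_1, ..., b x_(n-1), a x_n) = - f(b x_1, ..., b x_n, a x_(n-1)). *)
Definition bihom_skew a b f : Prop :=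
  forall (x : 'I_n -> V) (k l : 'I_n), l = k.+1 :> nat ->
    f (twist a b (x \o tperm k l)) = - f (twist a b x).

Definition compatible a f : Prop :=
  forall x : 'I_n -> V, a (f x) = f (a \o x).

(* The exponent n - k of the sign reads n - k.+1 as k : 'I_n starts at 0. *)
Definition bihom_jacobi a b br : Prop :=
  forall (x : 'I_n.-1 -> V) (y : 'I_n -> V),
    br (with_last (b \o b \o x) (br (twist a b y))) =
    \sum_(k < n) (-1) ^+ (n - k.+1) *:
      br (with_last (b \o b \o omit y k) (br (with_last (b \o x) (a (y k))))).

Record is_nBiHomLie br (a b : {linear V -> V}) : Prop := IsNBiHomLie {
  nbl_arity : (2 <= n)%N;
  nbl_multilinear : multilinear br;
  nbl_comm : forall v : V, a (b v) = b (a v);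
  nbl_compat_a : compatible a br;
  nbl_compat_b : compatible b br;
  nbl_skew : bihom_skew a b br;
  nbl_jacobi : bihom_jacobi a b br
}.

End BiHomLie.

Record nBiHomLieAlg (R : comNzRingType) (n : nat) (V : lmodType R) :=
  NBiHomLieAlg {
    bracket : ('I_n -> V) -> V;
    alpha : {linear V -> V};
    beta : {linear V -> V};
    nBiHomLieP : is_nBiHomLie bracket alpha beta
  }.

Section Cohomology.
Variables (K : comNzRingType) (n : nat) (g : lmodType K).
Variable A : nBiHomLieAlg n g.
Local Notation br := (bracket A).
Local Notation a := (alpha A).
Local Notation b := (beta A).
Implicit Types (f : ('I_n -> g) -> g).

Definition C1 : set {linear g -> g} :=
  [set f : {linear g -> g} |
    (forall v, f (a v) = a (f v)) /\ (forall v, f (b v) = b (f v))].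

Definition C2 : set (('I_n -> g) -> g) :=
  [set f | [/\ multilinear f, compatible a f, compatible b f
             & bihom_skew a b f]].

Definition delta1 (f : g -> g) : ('I_n -> g) -> g := fun x =>
  - f (br x) + \sum_(i < n) br (set_arg x i (f (x i))).

Definition delta2 f (x : 'I_n.-1 -> g) (y : 'I_n -> g) : g :=
  br (with_last (b \o b \o x) (f (twist a b y)))
  + f (with_last (b \o b \o x) (br (twist a b y)))
  - \sum_(i < n) (-1) ^+ (n - i.+1) *:
      (br (with_last (b \o b \o omit y i) (f (with_last (b \o x) (a (y i)))))
       + f (with_last (b \o b \o omit y i)
              (br (with_last (b \o x) (a (y i)))))).

Definition Z2 : set (('I_n -> g) -> g) :=
  [set f | C2 f /\ forall x y, delta2 f x y = 0].

Definition B2 : set (('I_n -> g) -> g) :=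
  [set delta1 (f : {linear g -> g}) | f in C1].


Lemma with_lastE (x : 'I_n.-1 -> g) :
  {i : 'I_n | forall z, with_last x z = set_arg (with_last x 0) i z}.
Proof.
have n0 : (0 < n)%N by apply: ltnW; exact: nbl_arity (nBiHomLieP A).
have n1 : (n.-1 < n)%N by rewrite ltn_predL.
exists (Ordinal n1) => z; apply/funext => j; rewrite /set_arg /with_last.
case: insubP => [k kn kj|]; case: eqVneq => //.
  by move=> jE; move: kn; rewrite jE /= ltnn.
move=> jN; rewrite -leqNgt => nj; case/eqP: jN; apply/val_inj => /=.
by apply/eqP; rewrite eqn_leq nj -ltnS prednK ?ltn_ord.
Qed.

Lemma bracket_last_linear (x : 'I_n.-1 -> g) c u v :
  br (with_last x (c *: u + v)) = c *: br (with_last x u) + br (with_last x v).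
Proof.
have [i xE] := with_lastE x.
by rewrite (xE (c *: u + v)) (xE u) (xE v) (nbl_multilinear (nBiHomLieP A)).
Qed.

Lemma delta2_linear c f1 f2 x y :
  delta2 (c *: f1 + f2) x y = c *: delta2 f1 x y + delta2 f2 x y.
Proof.
have cf u : (c *: f1 + f2) u = c *: f1 u + f2 u by [].
have addZ (p q p' q' : g) :
    c *: p + q + (c *: p' + q') = c *: (p + p') + (q + q').
  by rewrite addrACA scalerDr.
have scaleZ s (p q : g) : s *: (c *: p + q) = c *: (s *: p) + s *: q.
  by rewrite scalerDr !scalerA mulrC.
rewrite /delta2 !cf bracket_last_linear addZ.
under eq_bigr do rewrite !cf bracket_last_linear addZ scaleZ.
by rewrite big_split /= -scaler_sumr -scaleN1r scaleZ !scaleN1r addZ.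
Qed.

Fact Z2_submod : submod_closed [pred f | f \in Z2].
Proof.
have a0 : a 0 = 0 by exact: linear0. have b0 : b 0 = 0 by exact: linear0.
split=> [|c f1 f2]; rewrite !inE.
  have Z x y : delta2 0 x y = 0.
    have := delta2_linear (-1) 0 0 x y.
    by rewrite scaler0 addr0 scaleN1r addNr.
  split=> //; split=> [x i c u v|x|x|x k l _] /=.
  - by rewrite [RHS]addr0 [RHS]scaler0.
  - exact: a0.
  - exact: b0.
  - by rewrite [RHS]oppr0.
move=> [[m1 a1 b1 s1] d1] [[m2 a2 b2 s2] d2]; split; last first.
  by move=> x y; rewrite delta2_linear d1 d2 scaler0 addr0.
have cf u : (c *: f1 + f2) u = c *: f1 u + f2 u by [].
split=> [x i e u v|x|x|x k l kl]; rewrite !cf.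
- rewrite m1 m2 !scalerDr !scalerA addrACA; congr (_ + _ + (_ + _)).
  by rewrite mulrC.
- by rewrite linearP /= a1 a2.
- by rewrite linearP /= b1 b2.
- by rewrite (s1 _ _ _ kl) (s2 _ _ _ kl) scalerN opprD.
Qed.

HB.instance Definition _ := GRing.isSubmodClosed.Build K (('I_n -> g) -> g)
  [pred f | f \in Z2] Z2_submod.

Definition cocycle := {f : ('I_n -> g) -> g | f \in [pred f | f \in Z2]}.
HB.instance Definition _ := Choice.on cocycle.
HB.instance Definition _ := SubType.on cocycle.
HB.instance Definition _ := [SubChoice_isSubLmodule of cocycle by <:].

(* B^2 as a subspace of Z^2; as B^2 is contained in Z^2, restricting it to
   cocycles loses nothing. *)
Definition coboundary : {pred cocycle} := [pred z | val z \in B2].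

Lemma delta1B (f1 f2 : {linear g -> g}) :
  delta1 (f1 \- f2) = delta1 f1 - delta1 f2.
Proof.
apply/funext => x; rewrite /delta1 /=.
have brB i : br (set_arg x i (f1 (x i) - f2 (x i))) =
    br (set_arg x i (f1 (x i))) - br (set_arg x i (f2 (x i))).
  rewrite addrC -scaleN1r (nbl_multilinear (nBiHomLieP A)).
  by rewrite scaleN1r addrC.
under eq_bigr do rewrite brB.
by rewrite sumrB opprD addrACA -opprD.
Qed.

Fact coboundary_zmod : zmod_closed coboundary.
Proof.
have delta10 : delta1 (\0 : {linear g -> g}) = 0.
  rewrite -(subrr (delta1 (\0 : {linear g -> g}))) -delta1B; congr delta1.
  by apply/funext => v /=; rewrite subr0.
split=> [|z1 z2]; rewrite !inE.
  by exists \0; first by split=> v; rewrite /= linear0.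
move=> [f1 [a1 b1] f1E] [f2 [a2 b2] f2E]; exists (f1 \- f2).
  by split=> v; rewrite /= linearB ?a1 ?a2 ?b1 ?b2.
by rewrite delta1B f1E f2E.
Qed.

HB.instance Definition _ :=
  GRing.isZmodClosed.Build cocycle coboundary coboundary_zmod.

(* Z^2 / B^2, of which only the additive group structure is recorded. *)
Definition H2 := Quotient.quot coboundary.
HB.instance Definition _ := GRing.Zmodule.on H2.

End Cohomology.

(* Formal power series: X : fps V stands for \sum_m X m t^m.  Thus fps K is
   K[[t]], and fps V is V[[t]], a module over it. *)
Definition fps (V : Type) := nat -> V.

HB.instance Definition _ (V : choiceType) := Choice.on (fps V).
HB.instance Definition _ (V : zmodType) :=
  GRing.Zmodule.copy (fps V) (nat -> V).

Section PowerSeries.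
Variables (R : comNzRingType) (V : lmodType R).
Implicit Types (c d : fps R) (X Y : fps V).

Definition fps_scale c X : fps V :=
  fun m => \sum_(i < m.+1) c i *: X (m - i)%N.

Definition fps_one : fps R := fun m => (m == 0)%:R.

Fact fps_scaleA c d X :
  fps_scale c (fps_scale d X) =
    fps_scale (fun m => \sum_(i < m.+1) c i * d (m - i)%N) X.
Proof.
apply/funext => m; rewrite /fps_scale.
pose F i j := (c i * d j) *: X (m - i - j)%N.
transitivity (\sum_(i < m.+1) \sum_(k < m.+1 | (i <= k)%N) F i (k - i)%N).
  apply: eq_bigr => i _; rewrite scaler_sumr.
  under eq_bigr do rewrite scalerA -/(F _ _).
  rewrite -(big_mkord xpredT (F i)).
  rewrite -(big_mkord (fun k => i <= k)%N (fun k => F i (k - i)%N)).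
  rewrite -(big_nat_widenl _ _ _ xpredT) //.
  rewrite [RHS](big_addn 0 m.+1 i xpredT) subSn ?leq_ord //.
  by apply: eq_bigr => j _; rewrite addnK.
rewrite (exchange_big_dep predT) //=; apply: eq_bigr => k _.
rewrite scaler_suml (big_ord_narrow_leq (leq_ord k)) /=.
by apply: eq_bigr => i _; rewrite /F -subnDA subnKC // leq_ord.
Qed.

Fact fps_scale1 X : fps_scale fps_one X = X.
Proof.
apply/funext => m; rewrite /fps_scale big_ord_recl subn0 scale1r big1 ?addr0 //.
by move=> i _; rewrite scale0r.
Qed.

Fact fps_scaleDr : right_distributive fps_scale +%R.
Proof.
move=> c X Y; apply/funext => m; rewrite /fps_scale.
rewrite -[RHS]/((\sum_(_ < _) _) + (\sum_(_ < _) _)) -big_split.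
by apply: eq_bigr => i _; rewrite -[RHS]scalerDr.
Qed.

Fact fps_scaleDl X : {morph fps_scale^~ X : c d / c + d}.
Proof.
move=> c d; apply/funext => m; rewrite /fps_scale.
rewrite -[RHS]/((\sum_(_ < _) _) + (\sum_(_ < _) _)) -big_split.
by apply: eq_bigr => i _; rewrite -[RHS]scalerDl.
Qed.

End PowerSeries.

Section PowerSeriesRing.
Variable R : comNzRingType.
Implicit Types c d : fps R.

Definition fps_mul c d : fps R := fun m => \sum_(i < m.+1) c i * d (m - i)%N.

Let mulE : fps_mul = @fps_scale R R^o.
Proof. by []. Qed.

Fact fps_mulC : commutative fps_mul.
Proof.
move=> c d; apply/funext => m; rewrite /fps_mul (reindex_inj rev_ord_inj) /=.
by apply: eq_bigr => i _; rewrite subSS subKn ?leq_ord // mulrC.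
Qed.

Fact fps_mulA : associative fps_mul.
Proof. by move=> c d e; rewrite mulE fps_scaleA. Qed.

Fact fps_mul1 : left_id (fps_one R) fps_mul.
Proof. by move=> c; rewrite mulE fps_scale1. Qed.

Fact fps_mulDl : left_distributive fps_mul +%R.
Proof. by move=> c d e; rewrite mulE fps_scaleDl. Qed.

Fact fps_one_neq0 : fps_one R != 0.
Proof. by apply/eqP => /(congr1 (@^~ 0%N)) /eqP; rewrite oner_eq0. Qed.

HB.instance Definition _ := GRing.Zmodule_isComNzRing.Build (fps R)
  fps_mulA fps_mulC fps_mul1 fps_mulDl fps_one_neq0.

HB.instance Definition _ (V : lmodType R) :=
  GRing.Zmodule_isLmodule.Build (fps R) (fps V)
    (@fps_scaleA R V) (@fps_scale1 R V) (@fps_scaleDr R V) (@fps_scaleDl R V).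

End PowerSeriesRing.

(* The K[[t]]-linear extension of a. *)
Definition fps_map (K : comNzRingType) (V : lmodType K) (a : {linear V -> V})
  (X : fps V) : fps V := fun m => a (X m).

Fact fps_map_linear (K : comNzRingType) (V : lmodType K) (a : {linear V -> V}) :
  linear (fps_map a : fps V -> fps V).
Proof.
move=> c X Y; apply/funext => m; rewrite /fps_map.
rewrite [LHS]linearD; congr (_ + _); rewrite [LHS]linear_sum.
by apply: eq_bigr => i _; rewrite linearZ.
Qed.

HB.instance Definition _ (K : comNzRingType) (V : lmodType K)
    (a : {linear V -> V}) :=
  GRing.isLinear.Build (fps K) (fps V) (fps V) _ (fps_map a)
    (fps_map_linear a).

Section Deformations.
Variables (K : comNzRingType) (n : nat) (g : lmodType K).
Variable A : nBiHomLieAlg n g.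

(* The K[[t]]-linear map \sum_i psi_i t^i on g[[t]]. *)
Definition fps_linear (psi : nat -> {linear g -> g}) (X : fps g) : fps g :=
  fun m => \sum_(i < m.+1) psi i (X (m - i)%N).

(* The K[[t]]-n-linear map \sum_p f_p t^p on g[[t]]: the coefficient of t^m
   is the sum of f_p(X_1 e_1, ..., X_n e_n) over all p + e_1 + ... + e_n = m. *)
Definition fps_multilinear (f : nat -> ('I_n -> g) -> g)
    (X : 'I_n -> fps g) : fps g := fun m =>
  \sum_(p < m.+1)
    \sum_(e : {ffun 'I_n -> 'I_m.+1} | (p + \sum_j e j == m)%N)
      f p (fun j => X j (e j)).

Definition is_deformation (f : nat -> ('I_n -> g) -> g) : Prop :=
  [/\ forall p, multilinear (f p), f 0%N = bracket A
    & is_nBiHomLie (R := fps K) (fps_multilinear f)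
        (fps_map (alpha A)) (fps_map (beta A))].

Definition equivalent (f f' : nat -> ('I_n -> g) -> g) : Prop :=
  exists psi : nat -> {linear g -> g},
    [/\ psi 0%N =1 id,
        forall i v, psi i (alpha A v) = alpha A (psi i v),
        forall i v, psi i (beta A v) = beta A (psi i v)
      & forall X : 'I_n -> fps g,
          fps_linear psi (fps_multilinear f X) =
            fps_multilinear f' (fps_linear psi \o X)].

Definition null_deformation : nat -> ('I_n -> g) -> g :=
  fun p => if p == 0%N then bracket A else fun=> 0.

Definition analytically_rigid : Prop :=
  forall f, is_deformation f -> equivalent f null_deformation.

End Deformations.

(* Main.v *)
Require Import Defs.
From HB Require Import structures.
From mathcomp Require Import all_boot all_algebra.
From mathcomp Require Import all_fingroup ring_quotient.
From mathcomp Require Import boolp classical_sets.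

Import GRing.Theory.
Local Open Scope ring_scope.

(* Given a deformation f_t, a formal automorphism Psi_t with
   Psi_t o f_t = f_0 o (Psi_t, ..., Psi_t) is built one coefficient at a time.
   Put E = Psi_t o f_t - f_0 o (Psi_t, ..., Psi_t) and suppose that E = O(t^k).
   The coefficient D of t^k in E is a 2-cocycle: apply Psi_t to the Jacobi
   identity of f_t and subtract the Jacobi identity of f_0 at the arguments
   Psi_t(x), Psi_t(y); what is left at order k is delta^2 D = 0.  Since H^2 = 0,
   D = delta^1 h, and adding h to the coefficient psi_k subtracts delta^1 h
   from D without affecting lower orders. *)

(** * Substitution in argument tuples *)

Section Arguments.
Context {n : nat} {V : Type}.
Implicit Types (x : 'I_n -> V) (w : 'I_n.-1 -> V).

Lemma set_arg_id x i : set_arg x i (x i) = x.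
Proof. by apply/funext => j; rewrite /set_arg; case: eqP => // ->. Qed.

Lemma comp_set_arg {W : Type} (h : V -> W) x i u :
  h \o set_arg x i u = set_arg (h \o x) i (h u).
Proof. by apply/funext => j; rewrite /set_arg /=; case: eqP. Qed.

Lemma comp_with_last {W : Type} (h : V -> W) w z :
  h \o with_last w z = with_last (h \o w) (h z).
Proof. by apply/funext => j; rewrite /with_last /=; case: insub. Qed.

Lemma with_last_max w z (i : 'I_n) :
  (i < n.-1)%N = false -> with_last w z i = z.
Proof. by move=> iN; rewrite /with_last insubF. Qed.

Lemma with_last_lt w z (i : 'I_n) (ltin : (i < n.-1)%N) :
  with_last w z i = w (Ordinal ltin).
Proof. by rewrite /with_last insubT. Qed.

Lemma with_last_set_arg w i u z :
  with_last (set_arg w i u) z =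
    set_arg (with_last w z) (widen_ord (leq_pred n) i) u.
Proof.
apply/funext => j; rewrite /set_arg /with_last; case: insubP => [k kn kj|].
  by rewrite -!val_eqE /= kj.
by move=> jn; case: eqP => // jE; rewrite jE /= ltn_ord in jn.
Qed.

End Arguments.

(** * Operations that preserve multilinearity *)

Section Multilinear.
Context {R : comNzRingType} {n : nat} {V : lmodType R}.
Implicit Types (F G : ('I_n -> V) -> V).

Lemma multilinearB F G :
  multilinear F -> multilinear G -> multilinear (fun x => F x - G x).
Proof.
move=> Fl Gl x i c u v; rewrite Fl Gl opprD addrACA; congr (_ + _).
by rewrite scalerBr.
Qed.

Lemma multilinear_sum (I : finType) (F : I -> ('I_n -> V) -> V) :
  (forall k, multilinear (F k)) -> multilinear (fun x => \sum_k F k x).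
Proof.
move=> Fl x i c u v; rewrite scaler_sumr -big_split /=.
by apply: eq_bigr => k _; rewrite Fl.
Qed.

Lemma multilinear_scale (a : R) F :
  multilinear F -> multilinear (fun x => a *: F x).
Proof. by move=> Fl x i c u v; rewrite Fl scalerDr !scalerA mulrC. Qed.

Lemma multilinear_comp (L : V -> V) F :
  linear L -> multilinear F -> multilinear (L \o F).
Proof. by move=> Ll Fl x i c u v; rewrite /= Fl Ll. Qed.

(** As [s] is a bijection of a finite set, argument [i] of [x] enters exactly one slot of [F],
    namely [i0]. Precomposition, twisting and omission of an argument are all instances. *)
Lemma multilinear_reindex (s : 'I_n -> 'I_n) (L : 'I_n -> V -> V) F :
  injective s -> (forall j, linear (L j)) -> multilinear F ->
  multilinear (fun x => F (fun j => L j (x (s j)))).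
Proof.
move=> s_inj Ll Fl x i c u v; pose i0 := invF s_inj i.
have E z : (fun j => L j (set_arg x i z (s j))) =
    set_arg (fun j => L j (x (s j))) i0 (L i0 z).
  apply/funext => j; rewrite /set_arg -[i in s j == i](f_invF s_inj).
  by rewrite (inj_eq s_inj) -/i0; case: eqP => // ->.
by rewrite !E Ll Fl.
Qed.

Lemma multilinear_precomp (L : V -> V) F :
  linear L -> multilinear F -> multilinear (fun x => F (L \o x)).
Proof. by move=> Ll; apply: (multilinear_reindex id (fun=> L)). Qed.

Lemma multilinear_with_last F z :
  multilinear F -> multilinear (fun w : 'I_n.-1 -> V => F (with_last w z)).
Proof. by move=> Fl w i c u v; rewrite !with_last_set_arg Fl. Qed.

(** The last slot is the index n - 1, which exists because n > 0; filling it is an instance of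
    [set_arg]. *)
Lemma linear_with_last F w :
  (0 < n)%N -> multilinear F -> linear (fun z => F (with_last w z)).
Proof.
move=> n0 Fl c u v; have lt_n : (n.-1 < n)%N by rewrite prednK.
have E z : with_last w z = set_arg (with_last w 0) (Ordinal lt_n) z.
  apply/funext => j; rewrite /set_arg; case: eqVneq => [->|jN].
    by rewrite with_last_max //= ltnn.
  have jlt : (j < n.-1)%N.
    by rewrite ltn_neqAle -ltnS prednK // ltn_ord andbT -val_eqE in jN *.
  by rewrite !with_last_lt.
by rewrite (E (_ + _)) (E u) (E v) Fl.
Qed.

Lemma multilinear_set_arg0 F x i : multilinear F -> F (set_arg x i 0) = 0.
Proof.
move=> Fl; have := Fl x i (-1) 0 0.
by rewrite scaler0 addr0 scaleN1r addNr.
Qed.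

Lemma multilinearD F x i u v : multilinear F ->
  F (set_arg x i (u + v)) = F (set_arg x i u) + F (set_arg x i v).
Proof. by move=> Fl; rewrite -[u in LHS]scale1r Fl scale1r. Qed.

End Multilinear.

(** * Formal series and the orders of multilinear maps on them *)

Section FormalSeries.
Context {R : comNzRingType} {V : lmodType R}.
Implicit Types (X Y : fps V).

Definition fps_const (v : V) : fps V := fun m => if m == 0%N then v else 0.

Definition fps_Xn k : fps R := fun m => (m == k)%:R.

Lemma fps_scaleE (c : fps R) X m :
  (c *: X) m = \sum_(i < m.+1) c i *: X (m - i)%N.
Proof. by []. Qed.

Lemma fps_addE X Y m : (X + Y) m = X m + Y m.
Proof. by []. Qed.

Lemma fps_subE X Y m : (X - Y) m = X m - Y m.
Proof. by []. Qed.

Lemma fps_scaleXn k X m :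
  (fps_Xn k *: X) m = if (k <= m)%N then X (m - k)%N else 0.
Proof.
rewrite fps_scaleE /fps_Xn; case: leqP => km.
  rewrite (bigD1 (Ordinal (km : (k < m.+1)%N))) //= eqxx scale1r big1 ?addr0 //.
  by move=> i; rewrite -val_eqE => /negPf /= ->; rewrite scale0r.
rewrite big1 // => i _; rewrite ltn_eqF ?scale0r //.
by apply: leq_ltn_trans km; rewrite -ltnS.
Qed.

Lemma fps_scaleC (c : R) X m :
  (((fun m => if m == 0%N then c else 0) : fps R) *: X) m = c *: X m.
Proof.
rewrite fps_scaleE big_ord_recl subn0 big1 ?addr0 // => i _.
by rewrite scale0r.
Qed.

Lemma fps_shiftK k X : (forall m, (m < k)%N -> X m = 0) ->
  X = fps_Xn k *: ((fun m => X (k + m)%N) : fps V).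
Proof.
move=> X0; apply/funext => m; rewrite fps_scaleXn; case: leqP => km.
  by rewrite subnKC.
exact: X0.
Qed.

Lemma fps_const_shift X :
  X = fps_Xn 1%N *: ((fun m => X m.+1) : fps V) + fps_const (X 0%N).
Proof.
apply/funext => m; rewrite fps_addE fps_scaleXn /fps_const.
by case: m => [|m]; rewrite /= ?add0r // subn1 addr0.
Qed.

Lemma fps_signE e X m : ((-1) ^+ e *: X) m = (-1) ^+ e *: X m.
Proof.
rewrite -signr_odd -[in RHS]signr_odd.
by case: odd; rewrite ?expr0 ?expr1 ?scale1r // !scaleN1r.
Qed.

Lemma fps_sumE (I : finType) (X : I -> fps V) m :
  (\sum_i X i) m = \sum_i X i m.
Proof. by elim/big_rec2: _ => // i y x _ <-. Qed.

Section Evaluation.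
Variables (n : nat) (F : ('I_n -> fps V) -> fps V) (k : nat).
Hypothesis F_lin : multilinear F.
Hypothesis F_low :
  forall (x : 'I_n -> V) m, (m < k)%N -> F (fps_const \o x) m = 0.

(* Writing each argument as t X' + X_0, the terms with a factor t vanish up to
   order k by induction. *)
Lemma multilinear_fps_low (X : 'I_n -> fps V) m : (m <= k)%N ->
  F X m = F (fun i => fps_const (X i 0%N)) m.
Proof.
elim/ltn_ind: m X => m IH X mk.
(* The coefficient of t^m here is that of t^(m-1) in [F Y], which the induction hypothesis reduces
   to constant arguments, where [F_low] applies. *)
have shift0 (Y : 'I_n -> fps V) : (fps_Xn 1%N *: F Y) m = 0.
  rewrite fps_scaleXn; case: ltnP => // m0.
  have m1 : (m - 1 < m)%N by rewrite subn1 ltn_predL.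
  by rewrite IH ?F_low ?(leq_trans m1) // ltnW // (leq_trans m1).
(* The arguments are replaced by their constant terms one at a time, the first [j] of them in
   [E j]. *)
have E j : (j <= n)%N ->
    F X m = F (fun i => if (i < j)%N then fps_const (X i 0%N) else X i) m.
  elim: j => [//|j IHj] jn; rewrite IHj ?(ltnW jn) //; set Z := (Z in F Z _ = _).
  rewrite -(set_arg_id Z (Ordinal jn)) [Z (Ordinal jn)]fps_const_shift F_lin.
  rewrite fps_addE shift0 add0r; congr (F _ _); apply/funext => i.
  rewrite /set_arg /Z /= ltnn.
  case: (eqVneq i (Ordinal jn)) => [->|iN]; first by rewrite leqnn.
  by rewrite ltn_neqAle (iN : i != j :> nat).
by rewrite (E n) //; congr (F _ _); apply/funext => i; rewrite ltn_ord.
Qed.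

End Evaluation.

(** Vanishing on constant series is the low-order hypothesis of [multilinear_fps_low] for every
    order, so each coefficient of [F X] is one of [F] at the constant terms. This transfers
    identities from g to g[[t]]. *)
Lemma multilinear_fps_eq0 n (F : ('I_n -> fps V) -> fps V) :
  multilinear F -> (forall x : 'I_n -> V, F (fps_const \o x) = 0) ->
  forall X : 'I_n -> fps V, F X = 0.
Proof.
move=> Fl F0 X; apply/funext => m.
by rewrite (@multilinear_fps_low _ _ m) // => [|x p _]; rewrite F0.
Qed.

End FormalSeries.

(** * Multilinearity of expressions with a displaced argument *)

Section Multilinear.
Context {R : comNzRingType} {n : nat} {V : lmodType R}.
Implicit Types (F G : ('I_n -> V) -> V).

(** Moving argument [k] to the end is a permutation [s] of the arguments: the last slot reads [k],
    the others read [lift k]. The maps [M] depend on the slot only, so [multilinear_reindex]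
    applies. *)
Lemma multilinear_omit F k (L1 L2 : V -> V) :
  linear L1 -> linear L2 -> multilinear F ->
  multilinear (fun y => F (with_last (L1 \o omit y k) (L2 (y k)))).
Proof.
move=> l1 l2 Fl.
pose s (j : 'I_n) : 'I_n := if insub (j : nat) is Some i then lift k i else k.
pose M (j : 'I_n) := if (j < n.-1)%N then L1 else L2.
have sE : (fun y => F (with_last (L1 \o omit y k) (L2 (y k)))) =
    (fun y => F (fun j => M j (y (s j)))).
  apply/funext => y; congr F; apply/funext => j.
  rewrite /with_last /M /s; case: insubP => /= [i jn _|/negPf jn].
    by rewrite jn.
  by rewrite jn.
rewrite sE; apply: multilinear_reindex Fl => [i j|j]; last first.
  by rewrite /M; case: ifP.
(* Only one slot is not below n - 1, so [s] takes the value [k] once. *)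
have last_eq (u v : 'I_n) : ~~ (u < n.-1)%N -> ~~ (v < n.-1)%N -> u = v.
  have n0 : (0 < n)%N := leq_ltn_trans (leq0n u) (ltn_ord u).
  have E (w : 'I_n) : ~~ (w < n.-1)%N -> w = n.-1 :> nat.
    rewrite -leqNgt => w1; apply/eqP; rewrite eqn_leq w1 andbT.
    by rewrite -ltnS prednK.
  by move=> /E uE /E vE; apply: val_inj; rewrite /= uE vE.
rewrite /s; case: insubP => [u _ iE|iN]; case: insubP => [v _ jE|jN].
- by move=> /lift_inj uv; apply: val_inj; rewrite /= -iE -jE uv.
- by move=> kE; case/eqP: (neq_lift k u).
- by move=> kE; case/eqP: (neq_lift k v).
- by move=> _; apply: last_eq.
Qed.

Lemma multilinear_arg_sum F x i (I : finType) (P : pred I) (c : I -> R) u :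
  multilinear F ->
  F (set_arg x i (\sum_(l | P l) c l *: u l)) =
    \sum_(l | P l) c l *: F (set_arg x i (u l)).
Proof.
move=> Fl; elim/big_rec2: _ => [|l y v _ <-]; first exact: multilinear_set_arg0.
exact: Fl.
Qed.

End Multilinear.

(** * Linearity over formal series of the extended maps *)

Section FormalSeries.
Context {R : comNzRingType} {V : lmodType R}.

(** Both sums run over the pairs with i + l <= m, a condition symmetric in i and l. *)
Lemma triangle_exchange (W : nmodType) m (G : nat -> nat -> W) :
  \sum_(i < m.+1) \sum_(l < (m - i).+1) G i l =
    \sum_(l < m.+1) \sum_(i < (m - l).+1) G i l.
Proof.
have E (H : nat -> nat -> W) : \sum_(i < m.+1) \sum_(l < (m - i).+1) H i l =
    \sum_(i < m.+1) \sum_(l < m.+1 | (i + l <= m)%N) H i l.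
  apply: eq_bigr => i _.
  rewrite (big_ord_widen_cond m.+1 xpredT) ?ltnS ?leq_subr //=.
  by apply: eq_bigl => l; rewrite ltnS leq_subRL // -ltnS.
rewrite E (E (fun l i => G i l)) (exchange_big_dep xpredT) //=.
by apply: eq_bigr => l _; apply: eq_bigl => i; rewrite addnC.
Qed.

Lemma linear_fps_linear (psi : nat -> {linear V -> V}) :
  linear (fps_linear psi : fps V -> fps V).
Proof.
move=> c X Y; apply/funext => m; rewrite fps_addE fps_scaleE /fps_linear.
under eq_bigr do rewrite fps_addE fps_scaleE linearD linear_sum.
rewrite big_split /=; congr (_ + _).
under eq_bigr do under eq_bigr do rewrite linearZ /=.
rewrite (triangle_exchange _ _ (fun i l => c l *: psi i (X (m - i - l)%N))).
apply: eq_bigr => l _; rewrite scaler_sumr; apply: eq_bigr => i _.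
by rewrite subnAC.
Qed.

HB.instance Definition _ (psi : nat -> {linear V -> V}) :=
  GRing.isLinear.Build (fps R) (fps V) (fps V) _ (fps_linear psi)
    (linear_fps_linear psi).

Lemma fps_linear0 (psi : nat -> {linear V -> V}) (X : fps V) :
  fps_linear psi X 0%N = psi 0%N (X 0%N).
Proof. by rewrite /fps_linear big_ord1. Qed.

Section FpsMultilinear.
Variables (n : nat) (f : nat -> ('I_n -> V) -> V).
Implicit Types X : 'I_n -> fps V.

(** The condition that [p] and the exponents add up to [m] already bounds each of them by [m]. The
    larger index type allows coefficients of different orders to be compared term by term. *)
Lemma fps_multilinear_widen X m M : (m <= M)%N ->
  fps_multilinear f X m =
    \sum_(p < M.+1)
      \sum_(e : {ffun 'I_n -> 'I_M.+1} | (p + \sum_j e j == m)%N)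
        f p (fun j => X j (e j)).
Proof.
move=> mM; rewrite /fps_multilinear.
pose H p := \sum_(e : {ffun 'I_n -> 'I_m.+1} | (p + \sum_j e j == m)%N)
  f p (fun j => X j (e j)).
rewrite (big_ord_widen_cond M.+1 xpredT H) //= big_mkcond /=.
apply: eq_bigr => p _; case: ltnP => pm; last first.
  by rewrite big_pred0 // => e; rewrite gtn_eqF // ltn_addr.
have mM' : (m < M.+1)%N by [].
pose h (e : {ffun 'I_n -> 'I_m.+1}) : {ffun 'I_n -> 'I_M.+1} :=
  [ffun j => widen_ord mM' (e j)].
(* [inord] would send an exponent above [m] to 0, but the condition on the sum excludes such
   exponents. *)
pose h' (e : {ffun 'I_n -> 'I_M.+1}) : {ffun 'I_n -> 'I_m.+1} :=
  [ffun j => inord (e j)].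
have hK e : h' (h e) = e.
  by apply/ffunP => j; rewrite !ffunE /= inord_val.
rewrite [RHS](reindex_onto h h') => [|e /eqP eM]; last first.
  apply/ffunP => j; rewrite !ffunE; apply: val_inj; rewrite /= inordK //.
  by rewrite ltnS -eM (bigD1 j) //= addnCA leq_addr.
apply: eq_big => [e|e _]; last by congr (f p _); apply/funext=> j; rewrite ffunE.
rewrite hK eqxx andbT; congr (_ + _ == _)%N.
by apply: eq_bigr => j _; rewrite ffunE.
Qed.

Hypothesis f_lin : forall p, multilinear (f p).

(** Homogeneity in argument [i] for the single power t^l: lowering the exponent [e i] by [l] matches
    the terms in which argument [i] supplies t^l with the terms of order m - l. *)
Lemma fps_multilinear_shift X i (u : fps V) l m : (l <= m)%N ->
  \sum_(p < m.+1) \sum_(e : {ffun 'I_n -> 'I_m.+1} |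
      (p + \sum_j e j == m)%N && (l <= e i)%N)
    f p (set_arg (fun j => X j (e j)) i (u (e i - l)%N)) =
  fps_multilinear f (set_arg X i u) (m - l)%N.
Proof.
move=> lm; rewrite (@fps_multilinear_widen _ (m - l)%N m) ?leq_subr //.
apply: eq_bigr => p _.
(* [h] raises the exponent at [i] by [l] and [h'] lowers it; they are mutually inverse on the
   exponents that occur in the two sums. *)
pose h (e : {ffun 'I_n -> 'I_m.+1}) : {ffun 'I_n -> 'I_m.+1} :=
  [ffun j => if j == i then inord (e j + l) else e j].
pose h' (e : {ffun 'I_n -> 'I_m.+1}) : {ffun 'I_n -> 'I_m.+1} :=
  [ffun j => if j == i then inord (e j - l) else e j].
rewrite (reindex_onto h h') => [|e /andP[_ le]]; last first.
  have lt : (e i - l < m.+1)%N by rewrite (leq_ltn_trans (leq_subr _ _)).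
  apply/ffunP => j; rewrite !ffunE; case: eqVneq => // ->.
  by rewrite (inordK lt) subnK // inord_val.
have hE (e : {ffun 'I_n -> 'I_m.+1}) :
    (e i + l <= m)%N -> h e i = (e i + l)%N :> nat.
  by move=> em; rewrite ffunE eqxx inordK.
have hsum (e : {ffun 'I_n -> 'I_m.+1}) :
    (e i + l <= m)%N -> (\sum_j h e j = \sum_j e j + l)%N.
  move=> em; rewrite (bigD1 i) //= hE // [in RHS](bigD1 i) //= addnAC.
  by congr (_ + _ + _)%N; apply: eq_bigr => j /negPf jN; rewrite ffunE jN.
have hK (e : {ffun 'I_n -> 'I_m.+1}) : (e i + l <= m)%N -> h' (h e) = e.
  move=> em; apply/ffunP => j; rewrite [LHS]ffunE; case: eqVneq => [->|/negPf jN].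
    by apply: val_inj; rewrite hE // addnK inord_val.
  by rewrite ffunE jN.
(* inord sends an index above m to 0, so l <= h e i forces e i + l <= m. *)
have bounded (e : {ffun 'I_n -> 'I_m.+1}) : (l <= h e i)%N -> (e i + l <= m)%N.
  move=> le; rewrite leqNgt; apply/negP => em; move: le.
  rewrite ffunE eqxx /inord /insubd insubF /=; last by rewrite ltnNge em.
  by rewrite leqn0 => /eqP l0; move: em; rewrite l0 addn0 ltnNge -ltnS ltn_ord.
have small (e : {ffun 'I_n -> 'I_m.+1}) :
    (p + \sum_j e j == m - l)%N -> (e i + l <= m)%N.
  move=> /eqP eE; have : (e i <= m - l)%N.
    by rewrite -eE (bigD1 i) //= addnCA leq_addr.
  by rewrite leq_subRL // addnC.
apply: eq_big => [e|e /andP[/andP[_ le] _]].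
  apply/idP/idP => [/andP[/andP[/eqP hm le] _]|em].
    have em := bounded e le.
    by apply/eqP/(canRL (addnK l)); rewrite -addnA -hsum.
  have sm := small e em; rewrite hsum // addnA (eqP em) subnK // eqxx.
  by rewrite hE // leq_addl hK // eqxx.
have em := bounded e le.
congr (f p _); apply/funext => j; rewrite /set_arg; case: eqVneq => [->|/negPf jN].
  by rewrite hE // addnK.
by rewrite ffunE jN.
Qed.

(** The coefficient of order [e i] in [c *: u] is the sum of c_l u_(e i - l) over l <= e i.
    Collecting the terms with the same l gives c_l times a coefficient of order m - l, by
    [fps_multilinear_shift]. *)
Lemma multilinear_fps_multilinear : multilinear (fps_multilinear f).
Proof.
move=> X i c u v; apply/funext => m; rewrite fps_addE fps_scaleE.
have setE (z : fps V) (e : {ffun 'I_n -> 'I_m.+1}) :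
    (fun j => set_arg X i z j (e j)) = set_arg (fun j => X j (e j)) i (z (e i)).
  by apply/funext => j; rewrite /set_arg; case: eqP => // ->.
rewrite /(fps_multilinear f (set_arg X i (_ + _))).
under eq_bigr do under eq_bigr do rewrite setE fps_addE multilinearD //.
under eq_bigr do rewrite big_split.
rewrite big_split /=; congr (_ + _); last first.
  by apply: eq_bigr => p _; apply: eq_bigr => e _; rewrite setE.
have shift (l : 'I_m.+1) := fps_multilinear_shift X i u l m (leq_ord l).
under [RHS]eq_bigr do rewrite -shift scaler_sumr.
rewrite [RHS]exchange_big /=; apply: eq_bigr => p _.
under [RHS]eq_bigr do rewrite scaler_sumr.
rewrite [RHS](exchange_big_dep
    (fun e : {ffun 'I_n -> 'I_m.+1} => (p + \sum_j e j == m)%N)) /=;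
  last by move=> ? ? _ /andP[].
apply: eq_bigr => e em; rewrite fps_scaleE.
rewrite multilinear_arg_sum //.
rewrite (big_ord_widen_cond m.+1 xpredT
  (fun l => c l *: f p (set_arg (fun j => X j (e j)) i (u (e i - l)%N)))) //=.
by apply: eq_bigl => l; rewrite em ltnS.
Qed.

(** A nonzero exponent selects a zero coefficient of a constant series, so only the term with all
    exponents 0, and hence p = m, survives. *)
Lemma fps_multilinear_const m (x : 'I_n -> V) :
  fps_multilinear f (fps_const \o x) m = f m x.
Proof.
have f0 p (e : {ffun 'I_n -> 'I_m.+1}) : e != [ffun=> ord0] ->
    f p (fun j => (fps_const \o x) j (e j)) = 0.
  move=> e0; have [j ej] : exists j, e j != ord0.
    by apply/existsP; apply: contraNT e0; rewrite negb_exists => /forallP e0;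
      apply/eqP/ffunP => j; rewrite ffunE; apply/eqP/negPn/e0.
  rewrite -(set_arg_id (fun j => _) j) /= /fps_const.
  rewrite (negPf ej : (e j == 0 :> nat)%N = false).
  exact: multilinear_set_arg0.
rewrite /fps_multilinear (bigD1 ord_max) //= [X in _ + X]big1 => [|p pm].
  rewrite addr0 (bigD1 [ffun=> ord0]) /=; last first.
    by rewrite big1 ?addn0 // => j _; rewrite ffunE.
  rewrite big1 ?addr0 => [|e /andP[_ /f0 //]].
  by congr (f m _); apply/funext => j; rewrite /= ffunE.
apply: big1 => e /eqP em; apply: f0; apply: contraNneq pm => e0.
apply/eqP/val_inj; rewrite /= -[RHS]em e0 big1 ?addn0 // => j _.
by rewrite ffunE.
Qed.

End FpsMultilinear.

Lemma fps_multilinear0 n (f : nat -> ('I_n -> V) -> V) (X : 'I_n -> fps V) :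
  fps_multilinear f X 0%N = f 0%N (fun j => X j 0%N).
Proof.
rewrite /fps_multilinear big_ord1.
rewrite (big_pred1 [ffun=> ord0]) => [|e].
  by congr (f _ _); apply/funext => j; rewrite ffunE.
have -> : e = [ffun=> ord0] by apply/ffunP => j; rewrite ffunE ord1.
by rewrite /= eqxx big1 ?eqxx // => j _; rewrite ffunE.
Qed.

Lemma fps_multilinear_eq n (f : nat -> ('I_n -> V) -> V) (X Y : 'I_n -> fps V) m :
  (forall j p, (p <= m)%N -> X j p = Y j p) ->
  fps_multilinear f X m = fps_multilinear f Y m.
Proof.
move=> XY; apply: eq_bigr => p _; apply: eq_bigr => e _; congr (f p _).
by apply/funext => j; rewrite XY // -ltnS.
Qed.

Lemma compatible_fps_multilinear n (f : nat -> ('I_n -> V) -> V)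
    (a : {linear V -> V}) :
  (forall p, compatible a (f p)) ->
  compatible (fps_map a) (fps_multilinear f).
Proof.
move=> fa X; apply/funext => m; rewrite /fps_map /fps_multilinear linear_sum.
apply: eq_bigr => p _; rewrite linear_sum; apply: eq_bigr => e _.
exact: fa.
Qed.

Lemma fps_map_const (a : {linear V -> V}) v :
  fps_map a (fps_const v) = fps_const (a v).
Proof.
by apply/funext => m; rewrite /fps_map /fps_const; case: eqP; rewrite ?linear0.
Qed.

End FormalSeries.

(** * Twisted arguments under linear maps *)

Section Twist.
Context {R : comNzRingType} {n : nat} {V : lmodType R}.
Implicit Types (F : ('I_n -> V) -> V) (a b : V -> V).

Lemma comp_twist {W : Type} (h : V -> W) a b (a' b' : W -> W) (x : 'I_n -> V) :
  (forall v, h (a v) = a' (h v)) -> (forall v, h (b v) = b' (h v)) ->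
  h \o twist a b x = twist a' b' (h \o x).
Proof.
by move=> ha hb; apply/funext => i; rewrite /twist /=; case: eqP => _.
Qed.

Lemma multilinear_twist (s : 'I_n -> 'I_n) a b F :
  injective s -> linear a -> linear b -> multilinear F ->
  multilinear (fun x => F (twist a b (x \o s))).
Proof.
move=> s_inj al bl Fl.
have -> : (fun x => F (twist a b (x \o s))) =
    (fun x => F (fun j => (if j.+1 == n then a else b) (x (s j)))).
  apply/funext => x; congr F; apply/funext => j.
  by rewrite /twist /=; case: eqP.
apply: (multilinear_reindex s (fun j => if j.+1 == n then a else b)) => // j.
by case: eqP.
Qed.

End Twist.

(** * The bracket extended to formal series satisfies the identities of A *)

Section NullDeformation.
Context {K : comNzRingType} {n : nat} {g : lmodType K}.
Variable A : nBiHomLieAlg n g.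
Local Notation br := (bracket A).
Local Notation a := (alpha A).
Local Notation b := (beta A).
Local Notation brt := (fps_multilinear (null_deformation A)).
Local Notation at_ := (fps_map a).
Local Notation bt := (fps_map b).

Lemma multilinear_null p : multilinear (null_deformation A p).
Proof.
rewrite /null_deformation; case: eqP => _.
  exact: (nbl_multilinear (nBiHomLieP A)).
by move=> x i c u v; rewrite scaler0 addr0.
Qed.

Lemma multilinear_brt : multilinear brt.
Proof. exact: multilinear_fps_multilinear multilinear_null. Qed.

Lemma brt_const (x : 'I_n -> g) : brt (fps_const \o x) = fps_const (br x).
Proof.
apply/funext => m; rewrite (fps_multilinear_const _ _ multilinear_null).
by rewrite /null_deformation /fps_const; case: eqP.
Qed.

Lemma comp_fps_map_const (c : {linear g -> g}) m (x : 'I_m -> g) :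
  fps_map c \o (fps_const \o x) = fps_const \o (c \o x).
Proof. by apply/funext => j; rewrite /= fps_map_const. Qed.

Lemma twist_const (x : 'I_n -> g) :
  twist at_ bt (fps_const \o x) = fps_const \o twist a b x.
Proof.
by symmetry; apply: comp_twist => v; rewrite fps_map_const.
Qed.

(* Both sides are K[[t]]-multilinear, hence determined on constant series,
   where the identity is that of A. *)
Lemma brt_jacobi : bihom_jacobi at_ bt brt.
Proof.
have n0 : (0 < n)%N := ltnW (nbl_arity (nBiHomLieP A)).
have Bl := multilinear_brt.
have al : linear at_ by exact: linearP.
have bl : linear bt by exact: linearP.
have bbl : linear (bt \o bt) by move=> c u v; rewrite /= !linearP.
move=> X Y; apply/eqP; rewrite -subr_eq0; apply/eqP; move: Y.
apply: multilinear_fps_eq0.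
  apply: multilinearB.
    apply: (multilinear_comp (fun z => brt (with_last (bt \o bt \o X) z))).
      exact: linear_with_last.
    exact: (multilinear_twist id).
  apply: multilinear_sum => k; apply: multilinear_scale.
  apply: (multilinear_omit _ k (bt \o bt)
            (fun z => brt (with_last (bt \o X) (at_ z)))) => //.
  move=> c u v; rewrite [at_ _]linearP.
  exact: (linear_with_last brt (bt \o X)).
(* With [Y] reduced to constants, the same argument is applied to the n - 1 arguments [X]. *)
move=> y; move: X; apply: multilinear_fps_eq0.
  apply: multilinearB.
    apply: (multilinear_precomp (bt \o bt)
      (fun w => brt (with_last w (brt (twist at_ bt (fps_const \o y)))))) => //.
    exact: multilinear_with_last.
  apply: multilinear_sum => k; apply: multilinear_scale.
  apply: (multilinear_comp
    (fun z => brt (with_last (bt \o bt \o omit (fps_const \o y) k) z))).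
    exact: linear_with_last.
  apply: (multilinear_precomp bt
    (fun w => brt (with_last w (at_ ((fps_const \o y) k))))) => //.
  exact: multilinear_with_last.
move=> x; apply/funext => m.
have wl (w : 'I_n.-1 -> g) z :
    brt (with_last (fps_const \o w) (fps_const z)) =
    fps_const (br (with_last w z)).
  by rewrite -comp_with_last brt_const.
have bb w : (bt \o bt) \o (fps_const \o w) =
    fps_const \o (b \o b \o w) :> ('I_n.-1 -> _).
  by apply/funext => j; rewrite /= !fps_map_const.
have om k : omit (fps_const \o y) k = fps_const \o omit y k by [].
rewrite twist_const brt_const bb wl fps_subE fps_sumE.
under eq_bigr do
  rewrite fps_signE om bb comp_fps_map_const /= fps_map_const !wl.
apply/eqP; rewrite subr_eq0; apply/eqP.
rewrite {1}/fps_const (nbl_jacobi (nBiHomLieP A)); case: eqP => [m0|m0].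
  by apply: eq_bigr => k _; rewrite /fps_const m0.
rewrite big1 // => k _.
by rewrite /fps_const (negPf (introN eqP m0)) scaler0.
Qed.

(** Multilinearity reduces this to constant series, as for the Jacobi identity. *)
Lemma brt_skew : bihom_skew at_ bt brt.
Proof.
have al : linear at_ by exact: linearP.
have bl : linear bt by exact: linearP.
move=> X k l kl; rewrite -scaleN1r; apply/eqP; rewrite -subr_eq0; apply/eqP.
move: X; apply: multilinear_fps_eq0.
  apply: multilinearB; last apply: multilinear_scale.
    exact: (multilinear_twist (tperm k l) _ _ _ perm_inj al bl multilinear_brt).
  exact: (multilinear_twist id _ _ _ (@inj_id _) al bl multilinear_brt).
move=> x; rewrite scaleN1r opprK.
rewrite -[(_ \o x) \o _]/(fps_const \o (x \o tperm k l)).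
rewrite !twist_const !brt_const.
rewrite (nbl_skew (nBiHomLieP A)) //; apply/funext => m.
by rewrite fps_addE /fps_const; case: eqP; rewrite ?addNr ?addr0.
Qed.

Lemma brt_compatible (c : {linear g -> g}) :
  compatible c br -> compatible (fps_map c) brt.
Proof.
move=> cbr; apply: compatible_fps_multilinear => p x.
by rewrite /null_deformation; case: eqP => _; rewrite ?linear0 ?cbr.
Qed.

Lemma fps_map_fps_linear (c : {linear g -> g}) (psi : nat -> {linear g -> g})
    (X : fps g) : (forall i v, psi i (c v) = c (psi i v)) ->
  fps_map c (fps_linear psi X) = fps_linear psi (fps_map c X).
Proof.
move=> psic; apply/funext => m; rewrite /fps_map /fps_linear linear_sum.
by apply: eq_bigr => i _; rewrite psic.
Qed.

(** * The defect of a formal automorphism *)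

Definition defect (f : nat -> ('I_n -> g) -> g) (psi : nat -> {linear g -> g})
    (X : 'I_n -> fps g) : fps g :=
  fps_linear psi (fps_multilinear f X) - brt (fps_linear psi \o X).

Section Defect.
Variables (f : nat -> ('I_n -> g) -> g) (psi : nat -> {linear g -> g}).
Hypothesis f_def : is_deformation A f.
Hypothesis psi0 : psi 0%N =1 id.
Hypothesis psia : forall i v, psi i (a v) = a (psi i v).
Hypothesis psib : forall i v, psi i (b v) = b (psi i v).
Local Notation P := (fps_linear psi).
Local Notation F := (fps_multilinear f).
Local Notation E := (defect f psi).

Let f_lin p : multilinear (f p). Proof. by case: f_def. Qed.
Let f0 : f 0%N = br. Proof. by case: f_def. Qed.
Let f_alg : is_nBiHomLie (R := fps K) F at_ bt. Proof. by case: f_def. Qed.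
Let n0 : (0 < n)%N. Proof. exact: ltnW (nbl_arity f_alg). Qed.
Let Fl : multilinear F. Proof. exact: multilinear_fps_multilinear. Qed.
Let Bl : multilinear brt. Proof. exact: multilinear_brt. Qed.
Let Pat X : at_ (P X) = P (at_ X). Proof. exact: fps_map_fps_linear. Qed.
Let Pbt X : bt (P X) = P (bt X). Proof. exact: fps_map_fps_linear. Qed.

Lemma multilinear_defect : multilinear E.
Proof.
have Pl : linear (P : fps g -> fps g) := linear_fps_linear psi.
apply: multilinearB; first exact: multilinear_comp.
exact: multilinear_precomp.
Qed.

Lemma compatible_defect (c : {linear g -> g}) :
    (forall i v, psi i (c v) = c (psi i v)) ->
    compatible c br -> compatible (fps_map c) F ->
  compatible (fps_map c) E.
Proof.
move=> psic cbr cF X; rewrite /defect linearB /=.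
rewrite fps_map_fps_linear // cF brt_compatible //; congr (_ - brt _).
by apply/funext => i; rewrite /= fps_map_fps_linear.
Qed.

Lemma skew_defect : bihom_skew at_ bt E.
Proof.
move=> X k l kl; rewrite /defect (nbl_skew f_alg) //.
rewrite !(comp_twist P at_ bt at_ bt) // -[P \o (X \o _)]/((P \o X) \o _).
by rewrite brt_skew // linearN opprB addrC opprK.
Qed.

(** * The coefficient of lowest order in the defect as a 2-cocycle *)

Section Obstruction.
Variable k : nat.
Hypothesis defect_low :
  forall (x : 'I_n -> g) m, (m < k)%N -> E (fps_const \o x) m = 0.
Let D (x : 'I_n -> g) := E (fps_const \o x) k.

(** Substituting Psi(f_t(z)) = f_0(Psi z) + E(z) in the last slot turns the difference on the left
    into f_0(Psi w, E(z)) + E(w, f_t(z)). Since E has order at least k, at order k every other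
    series counts only through its constant term. The result is the pair of terms from which
    [delta2] is built. *)
Lemma defect_nested (w : 'I_n.-1 -> g) (z : 'I_n -> g) :
  (P (F (with_last (fps_const \o w) (F (fps_const \o z))))
    - brt (with_last (P \o (fps_const \o w)) (brt (P \o (fps_const \o z))))) k =
  br (with_last w (D z)) + D (with_last w (br z)).
Proof.
set U := with_last _ (F _).
have -> : brt (with_last (P \o (fps_const \o w)) (brt (P \o (fps_const \o z)))) =
    brt (P \o U)
    - brt (with_last (P \o (fps_const \o w)) (E (fps_const \o z))).
  rewrite /U comp_with_last; apply: (canRL (addrK _)).
  have := linear_with_last brt (P \o (fps_const \o w)) n0 Bl 1
    (brt (P \o (fps_const \o z))) (E (fps_const \o z)).
  by rewrite !scale1r => <-; rewrite /defect addrC subrK.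
rewrite opprB addrCA fps_addE -[P (F U) - _]/(E U); congr (_ + _).
  (* The factor t^k is taken out of E(z), which leaves the constant coefficient of the bracket;
     there Psi acts as [psi 0], the identity. *)
  rewrite (fps_shiftK k (E (fps_const \o z))) => [|m mk]; last exact: defect_low.
  have := linear_with_last brt (P \o (fps_const \o w)) n0 Bl (fps_Xn k)
    (fun m => E (fps_const \o z) (k + m)%N) 0.
  have -> : brt (with_last (P \o (fps_const \o w)) 0) = 0.
    have := linear_with_last brt (P \o (fps_const \o w)) n0 Bl (-1) 0 0.
    by rewrite scaler0 addr0 scaleN1r addNr.
  rewrite !addr0 => ->; rewrite fps_scaleXn leqnn subnn fps_multilinear0.
  congr br; apply/funext => i; rewrite /with_last; case: insub => [j|].
    by rewrite /= fps_linear0 psi0.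
  by rewrite /D addn0.
(* At order k the arguments of E may be replaced by their constant terms, and that of f_t(z) is the
   bracket of z. *)
rewrite (multilinear_fps_low n E k multilinear_defect defect_low) //.
congr (E _ k); apply/funext => i; congr fps_const.
rewrite /U /with_last; case: insub => [j //|].
by rewrite fps_multilinear0 f0.
Qed.

Lemma obstruction_Z2 : Z2 A D.
Proof.
have [_ _ _ ca cb _ _] := f_alg.
split; last first.
  move=> x y; rewrite /delta2 -defect_nested.
  under eq_bigr do rewrite -defect_nested.
  have bb m (w : 'I_m -> g) : (bt \o bt) \o (fps_const \o w) =
      fps_const \o (b \o b \o w).
    by apply/funext => j; rewrite /= !fps_map_const.
  have Pbb m (w : 'I_m -> g) : P \o (fps_const \o (b \o b \o w)) =
      (bt \o bt) \o (P \o (fps_const \o w)).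
    by rewrite -bb; apply/funext => j; rewrite /= -!Pbt.
  (* Psi applied to [jF], minus [jB], equates the nested differences of the two sides; their
     coefficients of order k are the terms of [delta2]. *)
  have jF := nbl_jacobi f_alg (fps_const \o x) (fps_const \o y).
  have jB := brt_jacobi (P \o (fps_const \o x)) (P \o (fps_const \o y)).
  rewrite bb twist_const in jF.
  rewrite -(comp_twist P at_ bt) // twist_const -Pbb in jB.
  rewrite jF jB linear_sum /= -sumrB fps_sumE -sumrB big1 // => i _.
  rewrite linearZ /= -scalerBr fps_signE -scalerBr.
  rewrite -[omit (fps_const \o y) i]/(fps_const \o omit y i).
  rewrite -[omit (P \o _) i]/(P \o (fps_const \o omit y i)) bb Pbb.
  have wl : fps_const \o with_last (b \o x) (a (y i)) =
      with_last (bt \o (fps_const \o x)) (at_ ((fps_const \o y) i)).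
    by rewrite comp_fps_map_const /= fps_map_const comp_with_last.
  rewrite wl comp_with_last -Pat.
  have -> : P \o (bt \o (fps_const \o x)) = bt \o (P \o (fps_const \o x)).
    by apply/funext => j; rewrite /= Pbt.
  by rewrite subrr scaler0.
split.
- move=> x i c u v.
  have cE w : fps_const \o set_arg x i w =
      set_arg (fps_const \o x) i (fps_const w) by rewrite comp_set_arg.
  rewrite [in LHS]/D cE.
  (* The scalar [c] becomes a constant power series, so that linearity of E over K[[t]] yields
     linearity of D over K. *)
  have -> : fps_const (c *: u + v) =
      ((fun m => if m == 0%N then c else 0) : fps K) *: fps_const u + fps_const v.
    apply/funext => m; rewrite fps_addE fps_scaleC /fps_const.
    by case: eqP; rewrite ?scaler0 ?addr0.
  by rewrite /D !cE -fps_scaleC -fps_addE -multilinear_defect.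
- move=> x; rewrite -[LHS]/(fps_map a (E (fps_const \o x)) k).
  rewrite compatible_defect ?comp_fps_map_const //.
  exact: (nbl_compat_a (nBiHomLieP A)).
- move=> x; rewrite -[LHS]/(fps_map b (E (fps_const \o x)) k).
  rewrite compatible_defect ?comp_fps_map_const //.
  exact: (nbl_compat_b (nBiHomLieP A)).
- move=> x i j ij; rewrite /D -!twist_const.
  by rewrite -[fps_const \o (x \o _)]/((fps_const \o x) \o _) skew_defect.
Qed.

End Obstruction.

End Defect.
End NullDeformation.

(** * First-order expansion of a multilinear map *)

Section Perturbation.
Context {R : comNzRingType} {V : lmodType R}.

(** Terms with two or more perturbed arguments have order at least 2k > k, so up to order k only the
    terms linear in W appear, each through its constant coefficient. *)
Lemma multilinear_fps_perturb n (F : ('I_n -> fps V) -> fps V)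
    (U W : 'I_n -> fps V) k :
  multilinear F -> (0 < k)%N ->
  F (fun i => U i + fps_Xn k *: W i) k =
    F U k + \sum_(i < n) F (set_arg U i (W i)) 0%N.
Proof.
move=> Fl k0.
have F0 (X Y : 'I_n -> fps V) : (forall i, X i 0%N = Y i 0%N) ->
    F X 0%N = F Y 0%N.
  (* For the bound 0 the low-order hypothesis is vacuous. *)
  move=> XY; rewrite (multilinear_fps_low n F 0) //.
  rewrite [RHS](multilinear_fps_low n F 0) //.
  by congr (F _ _); apply/funext => i; rewrite XY.
(* The perturbation is switched on one argument at a time, in the first [j] arguments of [Z j]. *)
pose Z j (i : 'I_n) := if (i < j)%N then U i + fps_Xn k *: W i else U i.
have E j : (j <= n)%N ->
    F (Z j) k = F U k + \sum_(i < n | (i < j)%N) F (set_arg U i (W i)) 0%N.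
  elim: j => [_|j IHj jn]; first by rewrite big_pred0 // addr0.
  pose o := Ordinal jn.
  have -> : Z j.+1 = set_arg (Z j) o (fps_Xn k *: W o + Z j o).
    apply/funext => i; rewrite /set_arg; case: (eqVneq i o) => [->|iN].
      by rewrite /Z /= ltnn ltnSn addrC.
    by rewrite /Z ltnS leq_eqVlt (negPf (iN : i != j :> nat)).
  rewrite Fl set_arg_id fps_addE fps_scaleXn leqnn subnn IHj ?(ltnW jn) //.
  rewrite [in RHS](bigD1 o) //= addrCA; congr (_ + (_ + _)).
    (* As k > 0, the arguments already perturbed still have the constant terms of U. *)
    apply: F0 => i; rewrite /set_arg; case: eqP => // _.
    rewrite /Z; case: ifP => // _.
    by rewrite fps_addE fps_scaleXn leqNgt k0 addr0.
  apply: eq_bigl => i.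
  by rewrite -val_eqE /= ltnS [in RHS]leq_eqVlt; case: ltngtP.
have -> : (fun i => U i + fps_Xn k *: W i) = Z n.
  by apply/funext => i; rewrite /Z ltn_ord.
by rewrite E //; congr (_ + _); apply: eq_bigl => i; rewrite ltn_ord.
Qed.

End Perturbation.

(** * Correction of the automorphism and rigidity *)

Section Rigidity.
Context {K : comNzRingType} {n : nat} {g : lmodType K}.
Variable A : nBiHomLieAlg n g.
Local Notation a := (alpha A).
Local Notation b := (beta A).
Local Notation brt := (fps_multilinear (null_deformation A)).

Definition perturb (psi : nat -> {linear g -> g}) k (h : {linear g -> g}) i :
    {linear g -> g} :=
  if i == k then (psi i \+ h : {linear g -> g}) else psi i.

Lemma fps_linear_perturb psi k h (X : fps g) :
  fps_linear (perturb psi k h) X = fps_linear psi X + fps_Xn k *: fps_map h X.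
Proof.
apply/funext => m; rewrite fps_addE fps_scaleXn /fps_linear /fps_map.
have E (i : 'I_m.+1) : perturb psi k h i (X (m - i)%N) =
    psi i (X (m - i)%N) + (if i == k :> nat then h (X (m - i)%N) else 0).
  by rewrite /perturb; case: eqP => // _; rewrite addr0.
under eq_bigr do rewrite E.
rewrite big_split /=; congr (_ + _); rewrite -big_mkcond /=.
case: leqP => km; last first.
  by rewrite big_pred0 // => i;
    rewrite ltn_eqF // (leq_ltn_trans _ km) // leq_ord.
rewrite (big_pred1 (Ordinal (km : (k < m.+1)%N))) //.
Qed.

(** Both terms of the defect involve, at order m, the coefficients of Psi up to order m only. Later
    corrections therefore do not spoil the orders already settled. *)
Lemma defect_eq f (psi psi' : nat -> {linear g -> g}) X m :
  (forall i, (i <= m)%N -> psi i =1 psi' i) ->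
  defect A f psi X m = defect A f psi' X m.
Proof.
move=> psiE.
have PE p (Y : fps g) : (p <= m)%N -> fps_linear psi Y p = fps_linear psi' Y p.
  move=> pm; apply: eq_bigr => i _; apply: psiE.
  by rewrite (leq_trans (leq_ord i)).
rewrite /defect !fps_subE PE //; congr (_ - _).
by apply: fps_multilinear_eq => j p pm; rewrite /= PE.
Qed.

(** At order k the summand h t^k adds h([x]) to Psi o f_t, because f_t starts with the bracket, and
    adds the brackets with one x_i replaced by h(x_i) to f_0 o Psi. The difference of the two is -
    delta^1 h. *)
Lemma defect_perturb f (psi : nat -> {linear g -> g}) k h (x : 'I_n -> g) :
  is_deformation A f -> psi 0%N =1 id -> (0 < k)%N ->
  defect A f (perturb psi k h) (fps_const \o x) k =
    defect A f psi (fps_const \o x) k - delta1 A h x.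
Proof.
move=> [f_lin f0 _] psi0 k0; rewrite /defect !fps_subE fps_linear_perturb.
have -> : fps_linear (perturb psi k h) \o (fps_const \o x) =
    (fun i => fps_linear psi (fps_const (x i))
              + fps_Xn k *: fps_map h (fps_const (x i))).
  by apply/funext => i; rewrite /= fps_linear_perturb.
rewrite multilinear_fps_perturb //; last exact: multilinear_brt.
rewrite fps_addE fps_scaleXn leqnn subnn /fps_map fps_multilinear0 f0.
rewrite /delta1 !opprD opprK addrACA; congr (_ + (_ - _)).
apply: eq_bigr => i _; rewrite fps_multilinear0; congr (bracket A _).
apply/funext => j; rewrite /set_arg; case: eqP => // _.
by rewrite fps_linear0 psi0.
Qed.

Lemma H2_trivial_coboundary :
  (forall z : H2 A, z = 0) -> forall f, Z2 A f -> B2 A f.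
Proof.
move=> H0 f fZ.
have fP : f \in [pred f | f \in Z2 A] by rewrite !inE.
pose z : cocycle A := Sub f fP.
have : z \in coboundary (A := A).
  (* Membership of z - 0 in [coboundary] is equality of the classes of z and 0 in the quotient, and
     both classes are 0. *)
  rewrite -[z]subr0 Quotient.idealrBE.
  apply/eqP; exact: etrans (H0 _) (esym (H0 _)).
by rewrite !inE.
Qed.

(** * Recursive construction of the automorphism *)

Section Construction.
Variable f : nat -> ('I_n -> g) -> g.
Hypothesis f_def : is_deformation A f.
Hypothesis H0 : forall z : H2 A, z = 0.

(** The condition is imposed on constant arguments, which determine a map multilinear over
    K[[t]]. *)
Definition intertwines_upto k (psi : nat -> {linear g -> g}) : Prop :=
  [/\ psi 0%N =1 id, forall i v, psi i (a v) = a (psi i v),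
      forall i v, psi i (b v) = b (psi i v)
    & forall (x : 'I_n -> g) m, (m <= k)%N ->
        defect A f psi (fps_const \o x) m = 0].

Lemma intertwines_step k psi : intertwines_upto k psi ->
  exists h, intertwines_upto k.+1 (perturb psi k.+1 h).
Proof.
move=> [psi0 psia psib low].
(* Vanishing up to order k makes the coefficient of order k + 1 a cocycle; [h] is a 1-cochain with
   this coboundary. *)
have [h [ha hb] hE] := H2_trivial_coboundary H0 _
  (obstruction_Z2 A f psi f_def psi0 psia psib k.+1 low).
exists h; split=> [v|i v|i v|x m mk].
- by rewrite /perturb.
- by rewrite /perturb; case: eqP => //= _; rewrite psia ha linearD.
- by rewrite /perturb; case: eqP => //= _; rewrite psib hb linearD.
move: mk; rewrite leq_eqVlt => /predU1P[->|mk].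
  by rewrite defect_perturb // hE subrr.
rewrite (defect_eq _ _ psi) ?low // => i im v.
by rewrite /perturb ltn_eqF // (leq_ltn_trans im).
Qed.

(** The corrections are chosen recursively. Stage k + 1 alters only coefficient k + 1, so the
    diagonal [s i i] agrees with stage m in all coefficients up to m. *)
Lemma exists_intertwiner : exists psi, forall k, intertwines_upto k psi.
Proof.
(* The property is stated as an implication so that a correction exists for every pair and [choice]
   gives a function; zero is the default where the premise fails. *)
have step (s : nat * (nat -> {linear g -> g})) : exists h,
    intertwines_upto s.1 s.2 -> intertwines_upto s.1.+1 (perturb s.2 s.1.+1 h).
  have [/intertwines_step[h sP]|sN] := pselect (intertwines_upto s.1 s.2).
    by exists h.
  by exists (\0 : {linear g -> g}).
have [H HP] := choice step.
pose s := fix s k : nat -> {linear g -> g} :=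
  if k is k'.+1 then perturb (s k') k'.+1 (H (k', s k'))
  else (fun i => if i == 0%N then (idfun : {linear g -> g})
                 else (\0 : {linear g -> g})).
have sP k : intertwines_upto k (s k).
  elim: k => [|k IH]; last exact: (HP (k, s k)).
  split=> [v|i v|i v|x m] //=.
  - by case: eqP => //= _; rewrite linear0.
  - by case: eqP => //= _; rewrite linear0.
  (* The starting series is the identity; at order 0 both terms of its defect are the bracket of
     A. *)
  rewrite leqn0 => /eqP->; rewrite /defect fps_subE fps_linear0 !fps_multilinear0.
  case: f_def => _ -> _; apply/eqP; rewrite subr_eq0; apply/eqP; congr bracket.
  by apply/funext => i; rewrite /= fps_linear0.
have sE k i : (i <= k)%N -> s k i = s i i.
  elim: k => [|k IH]; first by rewrite leqn0 => /eqP ->.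
  rewrite leq_eqVlt => /predU1P[-> //|ik].
  by rewrite /= /perturb ltn_eqF // IH.
exists (fun i => s i i) => k; split=> [v|i v|i v|x m mk].
- by case: (sP 0%N).
- by case: (sP i).
- by case: (sP i).
rewrite (defect_eq _ _ (s m)) => [|i im v]; last by rewrite sE.
by case: (sP m) => _ _ _ ->.
Qed.

End Construction.

(** The defect of the constructed series vanishes in every order on constant arguments, hence on all
    arguments by multilinearity; this is the equation of an equivalence. *)
Lemma H2_trivial_rigid : (forall z : H2 A, z = 0) -> analytically_rigid A.
Proof.
move=> H0 f f_def; have [psi psiP] := exists_intertwiner f f_def H0.
have [psi0 psia psib _] := psiP 0%N.
exists psi; split=> // X; apply/eqP; rewrite -subr_eq0; apply/eqP; move: X.
apply: (multilinear_fps_eq0 n (defect A f psi)).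
  exact: multilinear_defect.
move=> x; apply/funext => m; have [_ _ _ low] := psiP m.
exact: low.
Qed.

End Rigidity.

Theorem theorem5p9 (K : closedFieldType) (char0 : [pchar K] =i pred0)
    (n : nat) (g : lmodType K) (A : nBiHomLieAlg n g) :
  (forall h : H2 A, h = 0) -> analytically_rigid A.
Proof. exact: H2_trivial_rigid. Qed.
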